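(* For all $x,y\in\mathbb{H}^n$, $$\tanh\frac{\rho_{\mathbb{H}^n}(x,y)}{2}\le\tilde c_{\mathbb{H}^n}(x,y)\le 2\tanh\frac{\rho_{\mathbb{H}^n}(x,y)}{2},$$ and the constants are best possible: the constant $1$ in the lower bound cannot be replaced by a larger one, and the constant $2$ in the upper bound cannot be replaced by a smaller one, if the inequalities are to hold for all $x,y\in\mathbb{H}^n$.
   Context: $|\cdot|$ is the Euclidean norm and $\mathbb{H}^n=\{x\in\mathbb{R}^n: x_n>0\}$ is the upper half-space, where $x_n$ is the $n$th coordinate of $x$. The hyperbolic metric $\rho_{\mathbb{H}^n}\ge 0$ is given by $$\cosh\rho_{\mathbb{H}^n}(x,y)=1+\frac{|x-y|^2}{2x_ny_n},\quad\text{equivalently}\quad \tanh\frac{\rho_{\mathbb{H}^n}(x,y)}{2}=\frac{|x-y|}{\sqrt{|x-y|^2+4x_ny_n}}.$$ For a domain $G\subsetneq\mathbb{R}^n$ and $x,y\in G$, $$\tilde c_G(x,y)=\frac{|x-y|}{\inf_{z\in\partial G}\max\{|x-z|,|y-z|\}}.$$ *)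

(* Defs.v *)
From HB Require Import structures.
From mathcomp Require Import all_boot all_order all_algebra.
From mathcomp Require Import all_classical all_reals all_analysis.
From mathcomp Require Import ring lra.

Set Implicit Arguments.
Unset Strict Implicit.
Unset Printing Implicit Defensive.

Import Order.TTheory GRing.Theory Num.Theory.
Import numFieldNormedType.Exports.

Local Open Scope classical_set_scope.
Local Open Scope ring_scope.

Section hyperbolic_functions.
Variable R : realType.
Implicit Type t : R.

Definition cosh t : R := (expR t + expR (- t)) / 2.
Definition sinh t : R := (expR t - expR (- t)) / 2.
Definition tanh t : R := sinh t / cosh t.

Definition arcosh t : R := ln (t + Num.sqrt (t ^+ 2 - 1)).

Lemma arcosh_ge0 t : 1 <= t -> 0 <= arcosh t.
Proof.
by move=> t1; apply: ln_ge0; rewrite -[1]addr0 lerD// sqrtr_ge0.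
Qed.

Lemma arcoshK t : 1 <= t -> cosh (arcosh t) = t.
Proof.
move=> t1; have s0 := sqrtr_ge0 (t ^+ 2 - 1).
have s2 : Num.sqrt (t ^+ 2 - 1) ^+ 2 = t ^+ 2 - 1 by rewrite sqr_sqrtr//; nra.
rewrite /cosh /arcosh expRN.
set s := Num.sqrt _ in s0 s2 *.
have u0 : 0 < t + s by lra.
rewrite lnK ?posrE//.
have -> : (t + s)^-1 = t - s.
  apply: (mulfI (lt0r_neq0 u0)); rewrite mulfV ?lt0r_neq0//.
  by rewrite mulrC -subr_sqr s2; ring.
by field.
Qed.

End hyperbolic_functions.

(* The library norm `|v| on row vectors is the sup norm, which induces the same
   topology as the Euclidean norm but is a different function. *)
Definition enorm (R : realType) (n : nat) (v : 'rV[R]_n) : R :=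
  Num.sqrt (\sum_(i < n) v 0 i ^+ 2).

Definition frontier (T : topologicalType) (A : set T) : set T :=
  closure A `\` interior A.

(* If G is the whole space, then the infimum is over the empty set and the
   value is meaningless. *)
Definition ctilde (R : realType) (n : nat) (G : set 'rV[R]_n)
    (x y : 'rV[R]_n) : R :=
  enorm (x - y) /
  inf [set Num.max (enorm (x - z)) (enorm (y - z)) | z in frontier G].

(* The dimension is n.+1, so that there is a last coordinate. *)
Definition half_space (R : realType) (n : nat) : set 'rV[R]_n.+1 :=
  [set x | 0 < x 0 ord_max].
Arguments half_space : clear implicits.

Definition rho_half (R : realType) (n : nat) (x y : 'rV[R]_n.+1) : R :=
  arcosh (1 + enorm (x - y) ^+ 2 / (2 * x 0 ord_max * y 0 ord_max)).

(* On the half-space, rho_half x y is the only nonnegative real with this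
   hyperbolic cosine. *)
Section rho_half_characterization.
Variables (R : realType) (n : nat) (x y : 'rV[R]_n.+1).
Hypotheses (Hx : half_space R n x) (Hy : half_space R n y).

Let arg_ge1 : 1 <= 1 + enorm (x - y) ^+ 2 / (2 * x 0 ord_max * y 0 ord_max).
Proof.
by rewrite lerDl divr_ge0// ?sqr_ge0// !mulr_ge0// ltW.
Qed.

Lemma rho_half_ge0 : 0 <= rho_half x y.
Proof. exact: arcosh_ge0. Qed.

Lemma cosh_rho_half : cosh (rho_half x y) =
  1 + enorm (x - y) ^+ 2 / (2 * x 0 ord_max * y 0 ord_max).
Proof. exact: arcoshK. Qed.

End rho_half_characterization.

(* Main.v *)
Require Import Defs.
From mathcomp Require Import all_boot all_order all_algebra.
From mathcomp Require Import all_classical all_reals all_analysis.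
From mathcomp Require Import ring lra.

Import Order.TTheory GRing.Theory Num.Theory.
Import numFieldNormedType.Exports.
Local Open Scope classical_set_scope.
Local Open Scope ring_scope.

(* Write y* for the reflection of y in the boundary hyperplane, so that
   |x - y*|^2 = |x - y|^2 + 4 x_n y_n and tanh (rho(x, y) / 2) =
   |x - y| / |x - y*|.  For z on the boundary, |y - z| = |y* - z|, so the
   triangle inequality gives |x - y*| <= 2 max(|x - z|, |y - z|), while the
   point z where the segment [x, y*] meets the boundary satisfies
   max(|x - z|, |y - z|) <= |x - y*|.  For two points at heights s and t on a
   vertical line, the quotient of c~ by tanh (rho / 2) is (s + t) / max(s, t),
   which tends to 1 as t -> 0 and to 2 as t -> s. *)

(** With [a = exp(t / 2)], [c - 1] and [c + 1] are half the squares of [a - 1/a] and [a + 1/a];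
    [a >= 1] fixes the sign of the root. *)
Lemma tanh_half_arcosh {R : realType} (c : R) : 1 <= c ->
  tanh (arcosh c / 2) = Num.sqrt ((c - 1) / (c + 1)).
Proof.
move=> c1; set t := arcosh c.
have ct : (expR t + expR (- t)) / 2 = c by exact: arcoshK.
have t0 : 0 <= t / 2 by rewrite divr_ge0// arcosh_ge0.
pose a := expR (t / 2).
have a1 : 1 <= a by rewrite -expR0 ler_expR.
have a0 : 0 < a by lra.
have tE : expR t = a ^+ 2 by rewrite expr2 -expRD -splitr.
have b0 : 0 < a^-1 by rewrite invr_gt0.
have b1 : a^-1 <= 1 by rewrite invf_le1.
have an0 : a != 0 by rewrite gt_eqF.
have a2n0 : a ^+ 2 + 1 != 0 by rewrite gt_eqF//; nra.
rewrite expRN tE in ct.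
have -> : tanh (t / 2) = (a - a^-1) / (a + a^-1).
  by rewrite /tanh /sinh /cosh expRN -/a; field; rewrite an0 -expr2 a2n0.
have -> : (c - 1) / (c + 1) = ((a - a^-1) / (a + a^-1)) ^+ 2.
  rewrite -ct; field; rewrite an0 -?expr2 a2n0/=.
  by rewrite gt_eqF//; nra.
by rewrite sqrtr_sqr ger0_norm// divr_ge0//; lra.
Qed.

Lemma enorm_ge0 {R : realType} {n : nat} (v : 'rV[R]_n) : 0 <= enorm v.
Proof. exact: sqrtr_ge0. Qed.

Lemma enorm_sqr {R : realType} {n : nat} (v : 'rV[R]_n) :
  enorm v ^+ 2 = \sum_(i < n) v 0 i ^+ 2.
Proof. by rewrite sqr_sqrtr// sumr_ge0// => i _; exact: sqr_ge0. Qed.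

Lemma enorm_scale_last {R : realType} {n : nat} (s : R) :
  enorm (s *: delta_mx 0 ord_max : 'rV[R]_n.+1) = `|s|.
Proof.
rewrite /enorm (bigD1 ord_max)//= big1 => [|i /negPf iN].
  by rewrite !mxE !eqxx mulr1 addr0 sqrtr_sqr.
by rewrite !mxE iN andbF mulr0 expr0n.
Qed.

Lemma ler_last_enorm {R : realType} {n : nat} (v : 'rV[R]_n.+1) :
  v 0 ord_max <= enorm v.
Proof.
apply: (le_trans (ler_norm _)); rewrite -sqrtr_sqr ler_wsqrtr//.
by rewrite (bigD1 ord_max)//= lerDl sumr_ge0// => i _; exact: sqr_ge0.
Qed.

(** The distance |x - y*|, expanded so that y* is never formed. *)
Definition reflected_dist {R : realType} {n : nat} (x y : 'rV[R]_n.+1) : R :=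
  Num.sqrt (enorm (x - y) ^+ 2 + 4 * x 0 ord_max * y 0 ord_max).

Lemma frontier_half_space {R : realType} {n : nat} (z : 'rV[R]_n.+1) :
  frontier (half_space R n) z <-> z 0 ord_max = 0.
Proof.
pose h (v : 'rV[R]_n.+1) := v 0 ord_max.
have hc : continuous h by exact: coord_continuous.
have ho : open (half_space R n).
  by apply: (@open_comp _ _ h [set r | 0 < r]) => [? _|];
    [exact: hc|exact: open_gt].
rewrite /frontier (proj1 (interior_id _) ho).
split=> [[zc /negP]|z0].
  rewrite -leNgt => z_le0; apply/le_anti; rewrite z_le0/=.
  have cl : closed [set v | 0 <= h v].
    by apply: (@preimage_closed _ _ h [set r | 0 <= r]) => [? _|];
      [exact: hc|exact: closed_ge].
  have : half_space R n `<=` [set v | 0 <= h v] by move=> v; exact: ltW.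
  by move=> /closureS /(_ z zc); rewrite -(proj1 (closure_id _) cl).
split=> [B zB|]; last by rewrite /half_space /= z0 ltxx.
(* Moving [z] straight up enters the half-space at once, so every neighbourhood of [z] meets it. *)
pose f (t : R) : 'rV[R]_n.+1 := z + t *: delta_mx 0 ord_max.
have fc : {for 0, continuous f}.
  apply: cvgD; first exact: cvg_cst.
  by apply: cvgZr_tmp; exact: cvg_id.
have : nbhs 0 (f @^-1` B) by apply: fc; rewrite /f scale0r addr0.
have : closure [set t : R | 0 < t] 0 by rewrite closure_gt /=.
move=> /[apply] -[t [/= t0 Bt]]; exists (f t); split=> //.
by rewrite /half_space /= /f !mxE z0 !eqxx mulr1 add0r.
Qed.

Section half_space_points.
Context {R : realType} {n : nat} (x y : 'rV[R]_n.+1).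
Hypotheses (Hx : half_space R n x) (Hy : half_space R n y).

Let xn := x 0 ord_max.
Let yn := y 0 ord_max.
Let xn0 : 0 < xn. Proof. exact: Hx. Qed.
Let yn0 : 0 < yn. Proof. exact: Hy. Qed.

Lemma reflected_dist_gt0 : 0 < reflected_dist x y.
Proof.
rewrite sqrtr_gt0 ltr_wpDl ?sqr_ge0//.
by rewrite !mulr_gt0.
Qed.

Lemma reflected_dist_sqr :
  reflected_dist x y ^+ 2 = enorm (x - y) ^+ 2 + 4 * xn * yn.
Proof. by rewrite sqr_sqrtr// addr_ge0 ?sqr_ge0// !mulr_ge0// ltW. Qed.

Lemma tanh_half_rho :
  tanh (rho_half x y / 2) = enorm (x - y) / reflected_dist x y.
Proof.
have D0 := reflected_dist_gt0; have D2 := reflected_dist_sqr.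
have d0 := enorm_ge0 (x - y).
rewrite /rho_half -/xn -/yn tanh_half_arcosh; last first.
  by rewrite lerDl divr_ge0 ?sqr_ge0// !mulr_ge0// ltW.
rewrite -[RHS]ger0_norm ?divr_ge0 ?(ltW D0)// -sqrtr_sqr.
congr Num.sqrt; rewrite exprMn exprVn D2; field.
have xy0 : 0 < xn * yn by rewrite mulr_gt0.
by apply/and3P; split; rewrite gt_eqF//; nra.
Qed.

Lemma reflected_dist_le (z : 'rV[R]_n.+1) : z 0 ord_max = 0 ->
  reflected_dist x y <= 2 * Num.max (enorm (x - z)) (enorm (y - z)).
Proof.
move=> z0; set m := Num.max _ _.
have xm : enorm (x - z) <= m by rewrite le_max lexx.
have ym : enorm (y - z) <= m by rewrite le_max lexx orbT.
have x0 := enorm_ge0 (x - z); have y0 := enorm_ge0 (y - z).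
have D0 := reflected_dist_gt0; have D2 := reflected_dist_sqr.
(* A squared form of the triangle inequality, which splits over the coordinates. *)
suff : reflected_dist x y ^+ 2 <=
    2 * enorm (x - z) ^+ 2 + 2 * enorm (y - z) ^+ 2 by nra.
rewrite D2 !enorm_sqr !big_ord_recr/= !mxE -/xn -/yn z0.
set Sxy := \sum_(i < n) _; set Sx := \sum_(i < n) _; set Sy := \sum_(i < n) _.
(* The last coordinate contributes [(xn - yn)^2 + 4 xn yn = (xn + yn)^2], which is
   [2 xn^2 + 2 yn^2 - (xn - yn)^2]. *)
suff : Sxy <= 2 * Sx + 2 * Sy by have := sqr_ge0 (xn - yn); nra.
rewrite /Sxy /Sx /Sy !mulr_sumr -big_split/=; apply: ler_sum => i _.
rewrite !mxE; set a := x _ _; set b := y _ _; set c := z _ _.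
by have := sqr_ge0 ((a - c) + (b - c)); nra.
Qed.

(* The witness is the point where the segment from x to the reflection of y
   meets the boundary. *)
Lemma exists_boundary_le_reflected_dist : exists2 z : 'rV[R]_n.+1,
  z 0 ord_max = 0 &
  Num.max (enorm (x - z)) (enorm (y - z)) <= reflected_dist x y.
Proof.
exists (\row_i if i == ord_max then 0
               else (yn * x 0 i + xn * y 0 i) / (xn + yn)).
  by rewrite mxE eqxx.
have widenN (i : 'I_n) : (widen_ord (leqnSn n) i == ord_max) = false.
  by rewrite -val_eqE/= ltn_eqF.
have s0 : 0 < xn + yn by rewrite addr_gt0.
have sn0 : xn + yn != 0 by rewrite gt_eqF.
have xyn0 : 0 < xn * yn by rewrite mulr_gt0.
(* Horizontally, [x - z] and [y - z] are [x - y] and [y - x] scaled by [xn / (xn + yn)] and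
   [yn / (xn + yn)], both at most 1. *)
have contract (u c : R) : 0 <= u -> u <= xn + yn ->
    (u / (xn + yn) * c) ^+ 2 <= c ^+ 2.
  move=> u0 us; have ? : 0 <= u / (xn + yn) by rewrite divr_ge0// ltW.
  by rewrite exprMn ler_piMl ?sqr_ge0// expr_le1// ler_pdivrMr// mul1r.
rewrite ge_max; apply/andP; split; rewrite ler_wsqrtr// enorm_sqr.
- rewrite !big_ord_recr/= !mxE eqxx -/xn -/yn -addrA lerD//; last by nra.
  apply: ler_sum => i _; rewrite !mxE widenN.
  set a := x _ _; set b := y _ _.
  have -> : a - (yn * a + xn * b) / (xn + yn) = xn / (xn + yn) * (a - b).
    by field.
  by apply: contract; rewrite ?lerDl ltW.
- rewrite !big_ord_recr/= !mxE eqxx -/xn -/yn -addrA lerD//; last by nra.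
  apply: ler_sum => i _; rewrite !mxE widenN.
  set a := x _ _; set b := y _ _.
  have -> : b - (yn * a + xn * b) / (xn + yn) = yn / (xn + yn) * (b - a).
    by field.
  by rewrite -(sqrrN (a - b)) opprB; apply: contract; rewrite ?lerDr ltW.
Qed.

Let maxima :=
  [set Num.max (enorm (x - z)) (enorm (y - z)) | z in frontier (half_space R n)].

Lemma ge_inf_max_dist (z : 'rV[R]_n.+1) : z 0 ord_max = 0 ->
  inf maxima <= Num.max (enorm (x - z)) (enorm (y - z)).
Proof.
move=> /frontier_half_space z0; apply: ge_inf; last by exists z.
by exists 0 => _ [w _ <-]; rewrite le_max enorm_ge0.
Qed.

Lemma le_inf_max_dist (m : R) :
  (forall z : 'rV[R]_n.+1, z 0 ord_max = 0 ->
     m <= Num.max (enorm (x - z)) (enorm (y - z))) ->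
  m <= inf maxima.
Proof.
move=> mP; apply: lb_le_inf => [|_ [z /frontier_half_space z0 <-]];
  last exact: mP.
(* The origin lies on the boundary, so the infimum is not the default value of an empty set. *)
by exists (Num.max (enorm (x - 0)) (enorm (y - 0))), 0 => //;
  apply/frontier_half_space; rewrite mxE.
Qed.

(** The infimum lies between half of [reflected_dist x y] and all of it; dividing |x - y| by these
    reverses the order. *)
Lemma ctilde_half_space_bounds :
  tanh (rho_half x y / 2) <= ctilde (half_space R n) x y
    <= 2 * tanh (rho_half x y / 2).
Proof.
rewrite tanh_half_rho /ctilde -/maxima.
have D0 := reflected_dist_gt0; have d0 := enorm_ge0 (x - y).
have lo : reflected_dist x y / 2 <= inf maxima.
  by apply: le_inf_max_dist => z /reflected_dist_le; lra.
have hi : inf maxima <= reflected_dist x y.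
  have [z z0] := exists_boundary_le_reflected_dist.
  by apply: le_trans; exact: ge_inf_max_dist.
have i0 : 0 < inf maxima by lra.
apply/andP; split; first by rewrite ler_wpM2l// lef_pV2 ?posrE.
rewrite mulrCA ler_wpM2l// -[2]invrK -invfM lef_pV2 ?posrE//; last by lra.
by rewrite mulrC.
Qed.

End half_space_points.

(** At heights 1 and [t] the quotient of the two quantities is [1 + t], which serves both sharpness
    claims. *)
Lemma vertical_pair {R : realType} (n : nat) (t : R) : 0 < t < 1 ->
  exists x y : 'rV[R]_n.+1, [/\ half_space R n x, half_space R n y,
    tanh (rho_half x y / 2) = (1 - t) / (1 + t) &
    ctilde (half_space R n) x y = 1 - t].
Proof.
move=> /andP[t0 t1].
pose p (s : R) : 'rV[R]_n.+1 := s *: delta_mx 0 ord_max.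
have pn s : p s 0 ord_max = s by rewrite !mxE !eqxx mulr1.
have Hx : half_space R n (p 1) by rewrite /half_space /= pn.
have Hy : half_space R n (p t) by rewrite /half_space /= pn.
have dE : enorm (p 1 - p t) = 1 - t.
  by rewrite -scalerBl enorm_scale_last ger0_norm//; lra.
exists (p 1), (p t); split=> //.
  rewrite (tanh_half_rho _ _ Hx Hy) /reflected_dist dE !pn.
  have -> : (1 - t) ^+ 2 + 4 * 1 * t = (1 + t) ^+ 2 by ring.
  by rewrite sqrtr_sqr ger0_norm//; lra.
(* The origin attains the infimum 1, since every boundary point is at distance at least 1 from
   [p 1]. *)
rewrite /ctilde dE (_ : inf _ = 1) ?divr1//.
apply/le_anti/andP; split.
  apply: (le_trans (ge_inf_max_dist _ _ 0 _)); first by rewrite mxE.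
  by rewrite !subr0 !enorm_scale_last !gtr0_norm// ge_max lexx ltW.
apply: le_inf_max_dist => z z0; rewrite le_max; apply/orP; left.
by have := ler_last_enorm (p 1 - z); rewrite [X in X <= _]mxE pn mxE z0 subr0.
Qed.

Theorem corollary3p7 (R : realType) (n : nat) :
  [/\ forall x y : 'rV[R]_n.+1, half_space R n x -> half_space R n y ->
        tanh (rho_half x y / 2) <= ctilde (half_space R n) x y
          <= 2 * tanh (rho_half x y / 2),
      forall c : R,
        (forall x y : 'rV[R]_n.+1, half_space R n x -> half_space R n y ->
           c * tanh (rho_half x y / 2) <= ctilde (half_space R n) x y) ->
        c <= 1
    & forall C : R,
        (forall x y : 'rV[R]_n.+1, half_space R n x -> half_space R n y ->
           ctilde (half_space R n) x y <= C * tanh (rho_half x y / 2)) ->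
        2 <= C].
Proof.
split=> [x y|c cP|C CP]; first exact: ctilde_half_space_bounds.
- have cle (t : R) : 0 < t < 1 -> c <= 1 + t.
    move=> t01; have [x [y [Hx Hy tE ctE]]] := vertical_pair n t t01.
    have := cP _ _ Hx Hy; rewrite tE ctE mulrA ler_pdivrMr; last by lra.
    by rewrite mulrC ler_pM2l//; lra.
  have [//|c1] := leP c 1.
  (* For this [t], [1 + t = 2c / (c + 1)], which is below [c] when [c > 1]. *)
  have t01 : 0 < (c - 1) / (c + 1) < 1.
    by rewrite divr_gt0 ?ltr_pdivrMr//=; lra.
  have := cle _ t01; rewrite -lerBlDl ler_pdivlMr; nra.
- have Cge (t : R) : 0 < t < 1 -> 1 + t <= C.
    move=> t01; have [x [y [Hx Hy tE ctE]]] := vertical_pair n t t01.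
    have := CP _ _ Hx Hy; rewrite tE ctE mulrA ler_pdivlMr; last by lra.
    by rewrite mulrC ler_pM2r//; lra.
  (* This makes [C] positive, so that if [C < 2] then [t = C / 2] is admissible and gives
     [1 + C / 2 <= C], a contradiction. *)
  have C1 : 1 + 2^-1 <= C by apply: Cge; lra.
  have [//|C2] := leP 2 C.
  by have := Cge (C / 2); lra.
Qed.
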